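(* Let $I \subset S = \mathbb{C}[x_1,\dots,x_r]$ be a homogeneous ideal generated in degrees $\le n$, and let $x^{J_1},\dots,x^{J_N}$ be the minimal generators of $\mathrm{gin}(I)$ of degree $\le n$. Then every minimal generator $P$ of $\mathrm{gin}(I)$ of degree $n+1$ satisfies $P \prec x_i x^{J_j}$ for some $j$ with $|J_j| = n$ and some index $i < \max(J_j)$.
   Context: $\mathrm{gin}(I)$ denotes the generic initial ideal of $I$ with respect to the reverse lexicographic order $\succ$ with $x_1 \succ x_2 \succ \cdots \succ x_r$ (the initial ideal of $I$ after a generic linear change of coordinates); it is a Borel-fixed monomial ideal. For an exponent vector $J = (j_1,\dots,j_r)$, $x^J = x_1^{j_1}\cdots x_r^{j_r}$, $|J| = j_1+\cdots+j_r$, and $\max(J) = \max\{ i \mid j_i > 0\}$. The symbol $\prec$ denotes comparison in the reverse lexicographic order. *)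

(* Defs.v *)
From HB Require Import structures.
From mathcomp Require Import all_boot all_order all_algebra.
From mathcomp Require Import complex.
From mathcomp Require Import Rstruct.
From mathcomp Require Import mpoly.
From Stdlib Require Rdefinitions.

Set Implicit Arguments.
Unset Strict Implicit.
Unset Printing Implicit Defensive.

Import GRing.Theory.
Local Open Scope ring_scope.

Definition CC : fieldType := complex Rdefinitions.R.

(* Exponent vectors J = (j_1,...,j_r), 0-indexed: J i = j_{i+1}. *)

(* Homogeneous of degree d (the zero polynomial is homogeneous of every degree). *)
Definition homogeneous_of (r d : nat) (p : {mpoly CC[r]}) : Prop :=
  forall m, m \in msupp p -> mdeg m = d.

Definition in_ideal (r : nat) (gs : seq {mpoly CC[r]}) (p : {mpoly CC[r]}) : Prop :=
  exists cs : seq {mpoly CC[r]},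
    p = \sum_(k < size gs) cs`_k * gs`_k.

(* Degree reverse lexicographic order with x_1 > x_2 > ... > x_r:
   revlex_lt a b  <->  x^a < x^b, i.e. |a| < |b|, or |a| = |b| and the
   last nonzero coordinate of a - b is positive. *)
Definition revlex_lt (r : nat) (a b : 'X_{1..r}) : Prop :=
  (mdeg a < mdeg b)%N \/
  (mdeg a = mdeg b /\
   exists k : 'I_r, (b k < a k)%N /\ forall l : 'I_r, (k < l)%N -> a l = b l).

Definition lead_mono (r : nat) (p : {mpoly CC[r]}) (m : 'X_{1..r}) : Prop :=
  m \in msupp p /\ forall m', m' \in msupp p -> m' <> m -> revlex_lt m' m.

(* Monomials of the initial ideal in(J) of the ideal J generated by gs:
   x^m is in in(J) iff it is the leading monomial of some element of J
   (in(J) is spanned by the leading monomials of elements of J, and it is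
   closed under multiplication by monomials since J is an ideal). *)
Definition in_initial (r : nat) (gs : seq {mpoly CC[r]}) (m : 'X_{1..r}) : Prop :=
  exists p, in_ideal gs p /\ lead_mono p m.

Definition lin_change (r : nat) (g : 'M[CC]_r) (p : {mpoly CC[r]}) : {mpoly CC[r]} :=
  p \mPo [tuple (\sum_(j < r) g i j *: 'X_j) | i < r].

(* M (a set of monomials, i.e. a monomial ideal) is the generic initial ideal
   of the ideal generated by gs: there is a nonempty Zariski open subset of
   GL_r(C), namely { g | det g <> 0, f(g) <> 0 } for a nonzero polynomial f in
   the r*r entries of g, on which in(g.I) = M. *)
Definition is_gin (r : nat) (gs : seq {mpoly CC[r]}) (M : 'X_{1..r} -> Prop) : Prop :=
  exists f : {mpoly CC[r * r]},
    f != 0 /\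
    forall g : 'M[CC]_r,
      g \in unitmx ->
      meval (fun k => mxvec g 0 k) f != 0 ->
      forall m, M m <-> in_initial (map (lin_change g) gs) m.

Definition mdivides (r : nat) (a b : 'X_{1..r}) : Prop := forall i : 'I_r, (a i <= b i)%N.

Definition min_gen (r : nat) (M : 'X_{1..r} -> Prop) (m : 'X_{1..r}) : Prop :=
  M m /\ forall m', M m' -> mdivides m' m -> m' = m.

Definition mul_var (r : nat) (i : 'I_r) (J : 'X_{1..r}) : 'X_{1..r} :=
  [multinom (J k + (k == i))%N | k < r].

(* Main.v *)
(* The weight [wt B m = \sum_i m_i B^i] reverses the reverse lexicographic order
   on monomials of equal degree [< B], so leading monomials are those of least
   weight.

   Strong stability of gin (Galligo). Let [m] be in gin with [X_k | m], [i < k].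
   In generic coordinates the torus [X_j := s^(B^j) X_j] degenerates the ideal to
   its initial ideal as [s -> 0]; composing with the shear [X_k := X_k + X_i] and
   using that the composite is generic for almost all [s] produces an ideal
   element with leading monomial [X_i m / X_k]; the coefficient that appears is
   the exponent of [X_k] in [m], nonzero in characteristic 0.

   Theorem. Choose [h_u] in [I_n] with leading monomial [u], divisible by
   [X_(max u)] when [u] is not a minimal generator. As [I_(n+1) = S_1 I_n], it is
   spanned by the [X_k h_u]. Those with [k >= max u] have distinct leading
   monomials, which are not minimal generators. The others reduce to them modulo
   the [X_i h_J] with [J] a minimal generator of degree [n] and [i < max J]; if all
   of these had leading monomials below [P], then [P] could not lead an element
   of [I_(n+1)]. *)

Require Import Defs.
From Stdlib Require Import IndefiniteDescription ClassicalEpsilon.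
From mathcomp Require Import all_boot all_order all_algebra.
From mathcomp Require Import complex Rstruct.
From mathcomp Require Import mpoly.

Set Implicit Arguments.
Unset Strict Implicit.
Unset Printing Implicit Defensive.

Import GRing.Theory.
Local Open Scope ring_scope.

(** * Weights encoding the reverse lexicographic order *)

Definition wt (r B : nat) (m : 'X_{1..r}) : nat := (\sum_(i < r) m i * B ^ i)%N.

Lemma wtD r B (a b : 'X_{1..r}) : wt B (a + b)%MM = (wt B a + wt B b)%N.
Proof.
by rewrite /wt -big_split; apply: eq_bigr => i _; rewrite mnmDE mulnDl.
Qed.

Lemma wtU r B (k : 'I_r) : wt B U_(k)%MM = (B ^ k)%N.
Proof.
rewrite /wt (bigD1 k) //= mnm1E eqxx mul1n big1 ?addn0 // => i ne_ik.
by rewrite mnm1E eq_sym (negbTE ne_ik).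
Qed.

Lemma wt_le_bound r B (m : 'X_{1..r}) :
  (0 < B)%N -> (wt B m <= mdeg m * B ^ r)%N.
Proof.
move=> B_gt0; rewrite /wt mdegE big_distrl /=; apply: leq_sum => i _.
by rewrite leq_mul2l leq_pexp2l ?orbT // ltnW.
Qed.

(** As in base-[B] notation: the exponents of [b] below [k] sum to less than [B], so their weight
    stays under [B ^ k], one unit of the digit at [k]. *)
Lemma wt_lt_of_top r B (a b : 'X_{1..r}) (k : 'I_r) :
  (mdeg b < B)%N -> (b k < a k)%N -> (forall l : 'I_r, (k < l)%N -> a l = b l) ->
  (wt B b < wt B a)%N.
Proof.
move=> ltB lt_ba eq_above.
have low : (B * \sum_(i < r | (i < k)%N) b i * B ^ i <= mdeg b * B ^ k)%N.
  rewrite mdegE big_distrl big_distrr /=.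
  apply: (@leq_trans (\sum_(i < r | (i < k)%N) b i * B ^ k)).
    apply: leq_sum => i lt_ik; rewrite mulnCA -expnS leq_mul2l.
    by rewrite leq_pexp2l ?orbT //; apply: leq_ltn_trans ltB.
  by rewrite [X in (_ <= X)%N](bigID (fun i : 'I_r => (i < k)%N)) /= leq_addr.
have {}low : (\sum_(i < r | (i < k)%N) b i * B ^ i < B ^ k)%N.
  have B_gt0 : (0 < B)%N by apply: leq_ltn_trans ltB.
  rewrite -(ltn_pmul2l B_gt0); apply: leq_ltn_trans low _.
  by rewrite ltn_mul2r ltB expn_gt0 B_gt0.
have split3 (c : 'X_{1..r}) :
    wt B c = (\sum_(i < r | (i < k)%N) c i * B ^ i + c k * B ^ k
              + \sum_(i < r | (k < i)%N) c i * B ^ i)%N.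
  rewrite /wt (bigID (fun i : 'I_r => (i < k)%N)) /= -addnA; congr (_ + _)%N.
  rewrite (bigD1 k) /= ?ltnn //; congr (_ + _)%N; apply: eq_bigl => i.
  by rewrite -leqNgt ltn_neqAle andbC -(inj_eq val_inj) eq_sym.
rewrite !split3.
have -> : (\sum_(i < r | (k < i)%N) a i * B ^ i
           = \sum_(i < r | (k < i)%N) b i * B ^ i)%N.
  by apply: eq_bigr => i /eq_above ->.
rewrite ltn_add2r; apply: (@leq_trans ((b k).+1 * B ^ k)).
  by rewrite mulSn ltn_add2r.
by apply: leq_trans (leq_addl _ _); rewrite leq_mul2r lt_ba orbT.
Qed.

Lemma mnm_top_diff r (a b : 'X_{1..r}) : a != b ->
  exists k : 'I_r, a k != b k /\ forall l : 'I_r, (k < l)%N -> a l = b l.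
Proof.
move=> ne_ab; have [k0 ne0] : exists k, a k != b k.
  apply/existsP; apply: contraNT ne_ab; rewrite negb_exists => /forallP eq_ab.
  by apply/eqP/mnmP => i; apply/eqP; rewrite -[_ == _]negbK eq_ab.
case: (@arg_maxnP _ k0 (fun k => a k != b k) val ne0) => k ne_k max_k.
exists k; split=> // l; apply: contraTeq => /max_k.
by rewrite -leqNgt.
Qed.

Lemma wt_inj r B (a b : 'X_{1..r}) :
  (mdeg a < B)%N -> (mdeg b < B)%N -> wt B a = wt B b -> a = b.
Proof.
move=> aB bB; apply: contra_eq => /mnm_top_diff [k [ne_k above]].
case: ltngtP ne_k => // lt_k _.
  by rewrite neq_ltn (wt_lt_of_top aB lt_k) // => l /above.
by rewrite neq_ltn (wt_lt_of_top bB lt_k) ?orbT // => l /above.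
Qed.

Lemma revlex_ltP r B (a b : 'X_{1..r}) :
  mdeg a = mdeg b -> (mdeg b < B)%N -> revlex_lt a b <-> (wt B b < wt B a)%N.
Proof.
move=> eq_deg bB; split=> [[|[_ [k [lt_k above]]]]|lt_wt].
- by rewrite eq_deg ltnn.
- exact: wt_lt_of_top above.
right; split=> //.
have /mnm_top_diff [k [ne_k above]] : a != b.
  by apply: contraTneq lt_wt => ->; rewrite ltnn.
exists k; split=> //; case: ltngtP ne_k => // lt_k _.
suff : (wt B a < wt B b)%N by rewrite ltnNge ltnW.
by apply: (wt_lt_of_top _ lt_k) => [|l /above //]; rewrite eq_deg.
Qed.

(** * Homogeneous polynomials and their leading monomials *)

Lemma homogeneous_ofE r d (p : {mpoly CC[r]}) :
  homogeneous_of d p <-> p \is d.-homog.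
Proof. by split=> [h|/dhomogP //]; apply/dhomogP. Qed.

Lemma lead_monoP r B d (p : {mpoly CC[r]}) m :
  (d < B)%N -> p \is d.-homog ->
  lead_mono p m <-> m \in msupp p /\ {in msupp p, forall m', wt B m <= wt B m'}%N.
Proof.
move=> dB /dhomogP hp; split=> -[mp lead]; split=> // m' m'p.
  have [-> //|/eqP ne] := eqVneq m' m.
  by apply/ltnW/revlex_ltP; rewrite ?hp //; apply: lead.
move/eqP=> ne; apply/(@revlex_ltP _ B); rewrite ?hp //.
rewrite ltn_neqAle lead // andbT; apply: contra_neq ne => eq_wt.
by apply/esym/(wt_inj _ _ eq_wt); rewrite hp.
Qed.

Lemma lead_mono_exists r d (p : {mpoly CC[r]}) :
  p \is d.-homog -> p != 0 -> exists m, lead_mono p m.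
Proof.
move=> hp nz_p; pose Q w := has (fun m => wt d.+1 m == w) (msupp p).
have exQ : exists w, Q w.
  by exists (wt d.+1 (mlead p)); apply/hasP; exists (mlead p); rewrite ?mlead_supp.
case: (ex_minnP exQ) => w /hasP [m mp /eqP eq_w] min_w.
exists m; apply/(lead_monoP _ (ltnSn d) hp); split=> // m' m'p.
by rewrite eq_w min_w //; apply/hasP; exists m'.
Qed.

Lemma mem_msuppXM r (i : 'I_r) (p : {mpoly CC[r]}) m :
  m \in msupp ('X_i * p) -> exists2 m', m' \in msupp p & m = (U_(i) + m')%MM.
Proof. by rewrite mulrC (perm_mem (msuppMX _ _)) => /mapP. Qed.

Lemma dhomogXM r d (i : 'I_r) (p : {mpoly CC[r]}) :
  p \is d.-homog -> 'X_i * p \is d.+1.-homog.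
Proof. by move=> hp; rewrite -add1n dhomogM // dhomogX /= mdeg1. Qed.

Lemma lead_monoXM r d (i : 'I_r) (p : {mpoly CC[r]}) m :
  p \is d.-homog -> lead_mono p m -> lead_mono ('X_i * p) (U_(i) + m)%MM.
Proof.
move=> hp; have hXp := dhomogXM i hp.
move/(lead_monoP _ (leqW (ltnSn d)) hp) => [mp lead].
apply/(lead_monoP _ (ltnSn d.+1) hXp); split.
  by rewrite mcoeff_msupp mulrC mcoeffMX -mcoeff_msupp.
by move=> m' /mem_msuppXM [m'' m''p ->]; rewrite !wtD leq_add2l lead.
Qed.

(** * Ideal membership and homogeneous components *)

Lemma in_idealP r (gs : seq {mpoly CC[r]}) p :
  in_ideal gs p <->
  exists c : nat -> {mpoly CC[r]}, p = \sum_(k < size gs) c k * gs`_k.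
Proof.
split=> [[cs ->]|[c ->]]; first by exists (nth 0 cs).
exists (mkseq c (size gs)); apply: eq_bigr => k _.
by rewrite nth_mkseq.
Qed.

Lemma in_ideal0 r (gs : seq {mpoly CC[r]}) : in_ideal gs 0.
Proof. by apply/in_idealP; exists (fun=> 0); rewrite big1 // => k; rewrite mul0r. Qed.

Lemma in_idealD r (gs : seq {mpoly CC[r]}) p q :
  in_ideal gs p -> in_ideal gs q -> in_ideal gs (p + q).
Proof.
move=> /in_idealP [c ->] /in_idealP [c' ->]; apply/in_idealP.
exists (fun k => c k + c' k); rewrite -big_split.
by apply: eq_bigr => k _; rewrite mulrDl.
Qed.

Lemma in_idealM r (gs : seq {mpoly CC[r]}) p q :
  in_ideal gs q -> in_ideal gs (p * q).
Proof.
move=> /in_idealP [c ->]; apply/in_idealP; exists (fun k => p * c k).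
by rewrite mulr_sumr; apply: eq_bigr => k _; rewrite mulrA.
Qed.

Lemma in_idealZ r (gs : seq {mpoly CC[r]}) a p :
  in_ideal gs p -> in_ideal gs (a *: p).
Proof. by rewrite -mul_mpolyC; apply: in_idealM. Qed.

Lemma in_ideal_sum r (gs : seq {mpoly CC[r]}) (I : finType) (F : I -> {mpoly CC[r]}) :
  (forall i, in_ideal gs (F i)) -> in_ideal gs (\sum_i F i).
Proof. by move=> h; apply: big_ind => //; [apply: in_ideal0|apply: in_idealD]. Qed.

Lemma in_ideal_nth r (gs : seq {mpoly CC[r]}) k :
  (k < size gs)%N -> in_ideal gs gs`_k.
Proof.
move=> lt_k; apply/in_idealP; exists (fun j => (j == k)%:R).
rewrite (bigD1 (Ordinal lt_k)) //= eqxx mul1r big1 ?addr0 // => j ne_j.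
by rewrite (_ : (j == k :> nat) = false) ?mul0r //; apply/negbTE.
Qed.

(** Gives each generator a degree computed from it, in place of an existentially given one. For
    [p = 0] it is [0], within any bound. *)
Lemma homog_degree_le r d (p : {mpoly CC[r]}) :
  p \is d.-homog -> p \is ((msize p).-1).-homog /\ ((msize p).-1 <= d)%N.
Proof.
move=> hp; have hp' := dhomog_msize hp; split=> //.
have [->|nz_p] := eqVneq p 0; first by rewrite msize0.
by rewrite (dhomog_uniq nz_p hp' hp).
Qed.

(** Splitting the coefficients into monomials makes every term homogeneous, so the projection to
    degree [d] keeps it whole or kills it. *)
Lemma pihomog_ideal_ind r (gs : seq {mpoly CC[r]}) d (Q : {mpoly CC[r]} -> Prop) :
  (forall p, p \in gs -> p \is ((msize p).-1).-homog) ->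
  Q 0 -> (forall p q, Q p -> Q q -> Q (p + q)) ->
  (forall k a m, (k < size gs)%N -> (mdeg m + (msize gs`_k).-1 = d)%N ->
     Q (a *: ('X_[m] * gs`_k))) ->
  forall p, in_ideal gs p -> Q (pihomog mdeg d p).
Proof.
move=> hgs Q0 QD Qgen p /in_idealP [c ->]; rewrite raddf_sum /=.
apply: big_ind => // k _; rewrite [c k]mpolyE mulr_suml raddf_sum /=.
apply: big_ind => // m _; rewrite -scalerAl linearZ /=.
have hmk : 'X_[m] * gs`_k \is (mdeg m + (msize gs`_k).-1).-homog.
  by rewrite dhomogM ?dhomogX // hgs // mem_nth.
have [eq_d|ne_d] := eqVneq (mdeg m + (msize gs`_k).-1)%N d.
  by rewrite pihomog_dE -?eq_d //; apply: Qgen.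
by rewrite (pihomog_ne0 ne_d hmk) scaler0.
Qed.

Lemma in_ideal_pihomog r (gs : seq {mpoly CC[r]}) d p :
  (forall p, p \in gs -> p \is ((msize p).-1).-homog) ->
  in_ideal gs p -> in_ideal gs (pihomog mdeg d p).
Proof.
move=> hgs; apply: pihomog_ideal_ind => //; first exact: in_ideal0.
  exact: in_idealD.
by move=> k a m lt_k _; apply/in_idealZ/in_idealM/in_ideal_nth.
Qed.

Lemma in_initial_homog r (gs : seq {mpoly CC[r]}) m :
  (forall p, p \in gs -> p \is ((msize p).-1).-homog) ->
  in_initial gs m ->
  exists p, [/\ in_ideal gs p, p \is (mdeg m).-homog & lead_mono p m].
Proof.
move=> hgs [p [Ip [mp lead]]]; exists (pihomog mdeg (mdeg m) p).
have coefE m' : (pihomog mdeg (mdeg m) p)@_m' =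
    if mdeg m' == mdeg m then p@_m' else 0.
  rewrite pihomogE raddf_sum /=.
  under eq_bigr do rewrite mcoeffZ mcoeffX.
  have [m'p|m'Np] := boolP (m' \in msupp p).
    rewrite -big_filter; case: ifP => eq_deg; last first.
      rewrite big_filter big1 // => i /eqP eq_i.
      case: eqP => [eq_im'|]; last by rewrite mulr0.
      by rewrite -eq_im' eq_i eqxx in eq_deg.
    rewrite (bigD1_seq m') ?filter_uniq ?msupp_uniq ?mem_filter ?eq_deg //=.
    by rewrite eqxx mulr1 big1 ?addr0 // => i /negbTE ->; rewrite mulr0.
  rewrite (memN_msupp_eq0 m'Np) if_same big1_seq // => i /andP[_ ip].
  by case: eqP m'Np ip => [->|]; rewrite ?mulr0 // => /negbTE ->.
split; [exact: in_ideal_pihomog|exact: pihomogP|split].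
  by rewrite mcoeff_msupp coefE eqxx -mcoeff_msupp.
move=> m'; rewrite mcoeff_msupp coefE.
case: (mdeg m' =P mdeg m) => [_|]; last by rewrite eqxx.
by rewrite -mcoeff_msupp; apply: lead.
Qed.

(** This is [I_(n+1) = S_1 I_n]: a generator has degree at most [n], so its monomial factor in
    degree [n+1] is not [1] and gives up a variable. *)
Lemma in_ideal_succ r n (gs : seq {mpoly CC[r]}) p :
  (forall p, p \in gs -> p \is ((msize p).-1).-homog /\ ((msize p).-1 <= n)%N) ->
  in_ideal gs p -> p \is n.+1.-homog ->
  exists q : 'I_r -> {mpoly CC[r]},
    p = \sum_i 'X_i * q i /\ forall i, in_ideal gs (q i) /\ q i \is n.-homog.
Proof.
move=> hgs Ip hp; rewrite -(pihomog_dE hp).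
pose Q p := exists q : 'I_r -> {mpoly CC[r]},
  p = \sum_i 'X_i * q i /\ forall i, in_ideal gs (q i) /\ q i \is n.-homog.
apply: (@pihomog_ideal_ind r gs n.+1 Q) Ip => [q /hgs[] //|||].
- exists (fun=> 0); rewrite big1 => [|i _]; last by rewrite mulr0.
  by split=> // i; split; [apply: in_ideal0|apply: dhomog0].
- move=> p1 p2 [q1 [-> h1]] [q2 [-> h2]]; exists (fun i => q1 i + q2 i); split.
    by rewrite -big_split; apply: eq_bigr => i _; rewrite mulrDr.
  move=> i; have [[I1 d1] [I2 d2]] := (h1 i, h2 i).
  by split; [apply: in_idealD|apply: dhomogD].
move=> k a m lt_k deg_m; have [hk le_n] := hgs _ (mem_nth 0 lt_k).
have [i m_i] : exists i, (0 < m i)%N.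
  apply/existsP; apply: contra_eqT deg_m; rewrite negb_exists => /forallP m0.
  rewrite mdegE big1 => [|i _]; first by rewrite add0n neq_ltn ltnS le_n.
  by apply/eqP; rewrite -leqn0 leqNgt m0.
have leU : (U_(i) <= m)%MM.
  by apply/mnm_lepP => j; rewrite mnm1E; case: eqP => [<-|].
have mE : m = (U_(i) + (m - U_(i)))%MM by rewrite addmC submK.
exists (fun j => if j == i then a *: ('X_[m - U_(i)] * gs`_k) else 0); split.
  rewrite (bigD1 i) //= eqxx big1 ?addr0 => [|j /negbTE ->]; last by rewrite mulr0.
  by rewrite -scalerAr mulrA -mpolyXD -mE.
move=> j; case: eqP => _; last by split; [apply: in_ideal0|apply: dhomog0].
split; first by apply/in_idealZ/in_idealM/in_ideal_nth.
apply: dhomogZ; move: deg_m; rewrite {1}mE mdegD mdeg1 add1n addSn => -[<-].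
by rewrite dhomogM // dhomogX.
Qed.

(** * Strong stability, the form of Borel-fixedness in characteristic 0 *)

Definition strongly_stable r (M : 'X_{1..r} -> Prop) : Prop :=
  forall (m : 'X_{1..r}) (i k : 'I_r), (i < k)%N -> (0 < m k)%N -> M m ->
  M (U_(i) + (m - U_(k)))%MM.

Lemma submUK r (k : 'I_r) (m : 'X_{1..r}) :
  (0 < m k)%N -> (U_(k) + (m - U_(k)))%MM = m.
Proof.
by move=> mk; rewrite addmC submK //; apply/mnm_lepP => j; rewrite mnm1E; case: eqP => [<-|].
Qed.

Lemma mdeg_gt0P r (m : 'X_{1..r}) : (0 < mdeg m)%N ->
  exists k : 'I_r, (0 < m k)%N /\ forall l : 'I_r, (k < l)%N -> m l = 0%N.
Proof.
move=> deg_m; have : m != 0%MM by rewrite -mdeg_eq0 -lt0n.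
move/mnm_top_diff => [k [ne_k above]]; rewrite mnm0E in ne_k.
by exists k; rewrite lt0n; split=> // l /above; rewrite mnm0E.
Qed.

(** Some [u / X_j] lies in [M]. If [j < K = max(u)], strong stability exchanges [X_K] for [X_j] in
    it, which yields [u / X_K]. *)
Lemma not_min_gen r (M : 'X_{1..r} -> Prop) u :
  (forall i m, M m -> M (U_(i) + m)%MM) -> strongly_stable M ->
  M u -> ~ min_gen M u ->
  exists (K : 'I_r) (v : 'X_{1..r}),
    [/\ u = (U_(K) + v)%MM, M v & forall l : 'I_r, (K < l)%N -> u l = 0%N].
Proof.
move=> upM stM Mu nmin.
have [m' [Mm' m'u ne]] : exists m', [/\ M m', mdivides m' u & m' <> u].
  apply: NNPP => no; apply: nmin; split=> // m' Mm' m'u; apply: NNPP => ne.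
  by apply: no; exists m'.
have upM' d v : mdeg v = d -> forall m, M m -> M (v + m)%MM.
  elim: d v => [|d IH] v deg_v m Mm.
    by move/eqP: deg_v; rewrite mdeg_eq0 => /eqP ->; rewrite add0m.
  have [|k [vk _]] := @mdeg_gt0P _ v; first by rewrite deg_v.
  rewrite -(submUK vk) -addmA; apply/upM/IH => //.
  by move: deg_v; rewrite -{1}(submUK vk) mdegD mdeg1 => -[].
have [j lt_j] : exists j, (m' j < u j)%N.
  apply: NNPP => no; apply: ne; apply/mnmP => j; apply/eqP.
  by rewrite eqn_leq m'u leqNgt; apply/negP => lt_j; apply: no; exists j.
have uj : (0 < u j)%N by apply: leq_ltn_trans lt_j.
pose v := (u - U_(j))%MM; have uE : u = (U_(j) + v)%MM by rewrite submUK.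
have Mv : M v.
  have -> : v = ((v - m') + m')%MM.
    rewrite submK //; apply/mnm_lepP => l; rewrite mnmBE mnm1E.
    have [<-|_] /= := eqVneq j l; first by rewrite -ltnS -subSn // subn1.
    by rewrite subn0 m'u.
  exact: upM'.
have [|K [uK topK]] := @mdeg_gt0P _ u; first by rewrite uE mdegD mdeg1.
have [eq_jK|ne_jK] := eqVneq j K.
  by exists K, v; rewrite -eq_jK -uE; split=> // l; rewrite eq_jK => /topK.
have lt_jK : (j < K)%N.
  rewrite ltn_neqAle ne_jK leqNgt; apply/negP => /topK uj0.
  by rewrite uj0 in uj.
exists K, (u - U_(K))%MM; rewrite submUK //; split=> //.
have -> : (u - U_(K) = U_(j) + (v - U_(K)))%MM.
  apply/mnmP => l; rewrite mnmBE mnmDE mnmBE {1}uE mnmDE !mnm1E.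
  by case: eqP => [<-|_]; rewrite ?add0n // [K == j]eq_sym (negbTE ne_jK) !subn0.
apply: stM => //.
by move: uK; rewrite uE mnmDE mnm1E (negbTE ne_jK).
Qed.

(** * Reduction of the degree [n+1] part of the ideal *)

Lemma cancel_lead r B d (gs : seq {mpoly CC[r]}) q h u :
  (d < B)%N -> in_ideal gs q -> q \is d.-homog ->
  in_ideal gs h -> h \is d.-homog -> lead_mono h u ->
  {in msupp q, forall m, wt B u <= wt B m}%N ->
  exists (a : CC) q', [/\ q = q' + a *: h, in_ideal gs q', q' \is d.-homog
    & {in msupp q', forall m, wt B u < wt B m}%N].
Proof.
move=> dB Iq hq Ih hh /(lead_monoP _ dB hh) [uh lead] qu.
(* Killing the coefficient at [u] leaves strictly larger weights, since [wt] is injective in degree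
   [d]; [a] is [0] when [u] is absent from [q]. *)
pose a := q@_u / h@_u; exists a, (q - a *: h); split.
- by rewrite subrK.
- by rewrite -scaleNr; apply/in_idealD/in_idealZ.
- by rewrite rpredB // dhomogZ.
have hq' : q - a *: h \is d.-homog by rewrite rpredB // dhomogZ.
move=> m mq'; rewrite ltn_neqAle; apply/andP; split.
  apply/eqP => eq_wt; have eq_um : u = m.
    by apply: wt_inj eq_wt; rewrite ?(dhomog_mf hh uh) ?(dhomog_mf hq' mq').
  move: mq'; rewrite mcoeff_msupp mcoeffB mcoeffZ -eq_um divfK ?subrr ?eqxx //.
  by rewrite -mcoeff_msupp.
move/msuppB_le: mq'; rewrite mem_cat => /orP[/qu //|/msuppZ_le/lead //].
Qed.

(* [p] is a combination of products [X_k * h u] with [k >= max(u)], up to a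
   tail of monomials below the threshold [b] in the reverse lexicographic
   order (hence of weight above [b]). *)
Definition reduced r B n (M : 'X_{1..r} -> Prop) (h : 'X_{1..r} -> {mpoly CC[r]})
    (b : nat) (p : {mpoly CC[r]}) : Prop :=
  exists (c : 'X_{1..r < n.+1} * 'I_r -> CC) (e : {mpoly CC[r]}),
  [/\ p = \sum_x c x *: ('X_(x.2) * h x.1) + e,
      forall x, c x != 0 -> [/\ M x.1, mdeg x.1 = n &
        forall l : 'I_r, (x.2 < l)%N -> x.1%MM l = 0%N]
    & {in msupp e, forall m, b < wt B m}%N].

Lemma reduced_tail r B n M h b (e : {mpoly CC[r]}) :
  {in msupp e, forall m, b < wt B m}%N -> reduced B n M h b e.
Proof.
move=> he; exists (fun=> 0), e; split=> //; last by move=> x; rewrite eqxx.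
by rewrite big1 ?add0r // => x _; rewrite scale0r.
Qed.

Lemma reducedD r B n M h b (p q : {mpoly CC[r]}) :
  reduced B n M h b p -> reduced B n M h b q -> reduced B n M h b (p + q).
Proof.
move=> [c [e [-> hc he]]] [c' [e' [-> hc' he']]].
exists (fun x => c x + c' x), (e + e'); split.
- rewrite addrACA -big_split; congr (_ + _); apply: eq_bigr => x _.
  by rewrite scalerDl.
- move=> x; have [cx0|/hc //] := eqVneq (c x) 0.
  by rewrite cx0 add0r => /hc'.
by move=> m /msuppD_le; rewrite mem_cat => /orP[/he|/he'].
Qed.

Lemma reducedZ r B n M h b a (p : {mpoly CC[r]}) :
  reduced B n M h b p -> reduced B n M h b (a *: p).
Proof.
move=> [c [e [-> hc he]]]; exists (fun x => a * c x), (a *: e); split.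
- by rewrite scalerDr scaler_sumr; congr (_ + _); apply: eq_bigr => x _; rewrite scalerA.
- by move=> x; rewrite mulf_eq0 negb_or => /andP[_ /hc].
by move=> m /msuppZ_le /he.
Qed.

Lemma reduced_base r B n (M : 'X_{1..r} -> Prop) h b u (k : 'I_r) :
  M u -> mdeg u = n -> (forall l : 'I_r, (k < l)%N -> u l = 0%N) ->
  reduced B n M h b ('X_k * h u).
Proof.
move=> Mu deg_u top; have lt_u : (mdeg u < n.+1)%N by rewrite deg_u.
pose x0 : 'X_{1..r < n.+1} * 'I_r := (BMultinom lt_u, k).
exists (fun x => (x == x0)%:R), 0; split=> [|x|m]; last by rewrite msupp0.
  rewrite addr0 (bigD1 x0) //= eqxx scale1r big1 ?addr0 // => x /negbTE ->.
  by rewrite scale0r.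
by have [->|] := eqVneq x x0; rewrite ?eqxx.
Qed.

(** Among admissible pairs the products [X_k u] are distinct and differ from [P]. Nothing in [p] or
    in the tail has weight below that of [P], so the coefficients [c] vanish by induction on the
    weight of [X_k u], up to the weight of [P]; then nothing is left to produce [P]. *)
Lemma reduced_lead r n (M : 'X_{1..r} -> Prop) h (p : {mpoly CC[r]}) P :
  (forall u, M u -> mdeg u = n -> h u \is n.-homog /\ lead_mono (h u) u) ->
  mdeg P = n.+1 -> (forall u (k : 'I_r), M u -> P <> (U_(k) + u)%MM) ->
  p \is n.+1.-homog -> lead_mono p P -> ~ reduced n.+2 n M h (wt n.+2 P) p.
Proof.
move=> hh degP nP hp /(lead_monoP _ (ltnSn _) hp) [Pp leadP] [c [e [pE hc he]]].
have lead_u x m : c x != 0 -> ('X_(x.2) * h x.1)@_m != 0 ->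
    (wt n.+2 (U_(x.2) + x.1)%MM <= wt n.+2 m)%N.
  move=> /hc [Mx degx _]; have [hx leadx] := hh _ Mx degx.
  have /(lead_monoP _ (leqW (ltnSn n)) hx) [_ {}leadx] := leadx.
  rewrite -mcoeff_msupp => /mem_msuppXM [m' /leadx le_m' ->].
  by rewrite !wtD leq_add2l.
have c0 N (x : 'X_{1..r < n.+1} * 'I_r) :
    (wt n.+2 (U_(x.2) + x.1)%MM < N)%N -> (N <= (wt n.+2 P).+1)%N -> c x = 0.
  elim: N x => // N IH x lt_x le_N; apply/eqP/contraT => nz_c.
  have [Mx degx topx] := hc _ nz_c; have [hx leadx] := hh _ Mx degx.
  pose m0 := (U_(x.2) + x.1)%MM.
  have deg0 : mdeg m0 = n.+1 by rewrite mdegD mdeg1 degx.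
  have lt0 : (wt n.+2 m0 < wt n.+2 P)%N.
    rewrite ltn_neqAle -ltnS (leq_trans lt_x le_N) andbT.
    by apply/eqP => /wt_inj eq0; apply: (nP x.1 x.2) => //; apply/esym/eq0; rewrite ?deg0 ?degP.
  have pm0 : p@_m0 = 0.
    apply: memN_msupp_eq0; apply: contraTN lt0 => /leadP.
    by rewrite leqNgt.
  have em0 : e@_m0 = 0.
    apply: memN_msupp_eq0; apply: contraTN lt0 => /he.
    by rewrite -leqNgt => /ltnW.
  (* Compare coefficients at [m0]: other products starting at a smaller weight vanish by induction,
     and those starting at a larger one do not reach [m0]. *)
  move: pm0; rewrite pE mcoeffD em0 addr0 raddf_sum /= (bigD1 x) //= big1 ?addr0.
    rewrite mcoeffZ mulrC [_ * h _]mulrC mcoeffMX => /eqP.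
    rewrite mulf_eq0 (negbTE nz_c) orbF.
    by rewrite mcoeff_eq0; case: leadx => ->.
  move=> y ne_yx; rewrite mcoeffZ; apply/eqP; rewrite mulf_eq0.
  apply/contraT; rewrite negb_or => /andP[nz_y nz_ym].
  have le_y := lead_u _ _ nz_y nz_ym.
  have [eq_y|ne_y] := eqVneq (wt n.+2 (U_(y.2) + y.1)%MM) (wt n.+2 m0); last first.
    have lt_y : (wt n.+2 (U_(y.2) + y.1)%MM < N)%N.
      by apply: leq_trans (_ : wt n.+2 m0 <= N)%N; rewrite // ltn_neqAle ne_y.
    by rewrite (IH _ lt_y (ltnW le_N)) eqxx in nz_y.
  have [My degy topy] := hc _ nz_y.
  have {}eq_y : (U_(y.2) + y.1)%MM = m0.
    by apply: wt_inj eq_y; rewrite ?deg0 // mdegD mdeg1 degy.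
  (* An admissible pair is determined by its product, [k] being the index of the last variable in
     it. *)
  have eq2 : y.2 = x.2.
    have at_l l := congr1 (fun m : 'X_{1..r} => m l) eq_y.
    apply/val_inj/eqP; case: ltngtP => // lt_yx.
      move: (at_l x.2); rewrite !mnmDE !mnm1E eqxx (topy _ lt_yx).
      by rewrite (_ : y.2 == x.2 = false) // -(inj_eq val_inj) ltn_eqF.
    move: (at_l y.2); rewrite !mnmDE !mnm1E eqxx (topx _ lt_yx).
    by rewrite (_ : x.2 == y.2 = false) // -(inj_eq val_inj) ltn_eqF.
  case/eqP: ne_yx; move: eq_y eq2; rewrite /m0.
  case: (y) (x) => [y1 y2] [x1 x2] /= + eq2; rewrite eq2 => /addmI eq1.
  by congr (_, _); apply: val_inj.
move: Pp; rewrite mcoeff_msupp => /negP; apply; apply/eqP.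
rewrite pE mcoeffD raddf_sum /= big1 => [|x _]; last first.
  rewrite mcoeffZ; apply/eqP; rewrite mulf_eq0; apply/contraT.
  rewrite negb_or => /andP[nz_x /(lead_u _ _ nz_x) le_x].
  by rewrite (c0 (wt n.+2 P).+1 x) ?eqxx // in nz_x.
by rewrite add0r; apply: memN_msupp_eq0; apply/negP => /he; rewrite ltnn.
Qed.

(* Syzygies of a strongly stable ideal are generated by the pairs [X_k * u]
   with [k < max(u)] (Eliahou-Kervaire); when [u] is not a minimal generator,
   [h u] is divisible by [X_(max u)], which trades such a pair for an
   admissible one plus terms lower in the order. *)
Lemma reduced_XM r n (gs : seq {mpoly CC[r]}) (M : 'X_{1..r} -> Prop) h b :
  (forall m, M m <-> in_initial gs m) ->
  (forall u, M u -> mdeg u = n ->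
    [/\ in_ideal gs (h u), h u \is n.-homog, lead_mono (h u) u &
        min_gen M u \/ exists (K : 'I_r) h' d v,
          [/\ h u = 'X_K * h', n = d.+1, in_ideal gs h' /\ h' \is d.-homog,
              lead_mono h' v & u = (U_(K) + v)%MM /\
              forall l : 'I_r, (K < l)%N -> u l = 0%N]]) ->
  (forall (J : 'X_{1..r}) (i k : 'I_r), min_gen M J -> mdeg J = n -> (i < k)%N ->
     (0 < J k)%N -> (b < wt n.+2 (U_(i) + J)%MM)%N) ->
  forall q (k : 'I_r), in_ideal gs q -> q \is n.-homog ->
  reduced n.+2 n M h b ('X_k * q).
Proof.
move=> ME hh hb; pose w := @wt r n.+2.
(* [N] bounds the room left under an upper bound for the weights in degree [n+1]; each reduction
   raises the weights, so the room shrinks. *)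
suff red N q (k : 'I_r) : in_ideal gs q -> q \is n.-homog ->
    {in msupp q, forall m, n.+1 * n.+2 ^ r < N + w (U_(k) + m)%MM}%N ->
    reduced n.+2 n M h b ('X_k * q).
  move=> q k Iq hq; apply: (red (n.+1 * n.+2 ^ r).+1) => // m _.
  by rewrite addSn ltnS leq_addr.
elim: N q k => [|N IH] q k Iq hq qN.
  suff -> : q = 0 by rewrite mulr0; apply: reduced_tail => m; rewrite msupp0.
  apply/eqP; rewrite -msupp_eq0; case E: (msupp q) => [//|m s].
  have mq : m \in msupp q by rewrite E mem_head.
  have := qN _ mq; rewrite add0n ltnNge.
  suff -> : (w (U_(k) + m)%MM <= n.+1 * n.+2 ^ r)%N by [].
  apply: leq_trans (wt_le_bound _ _) _ => //.
  by rewrite mdegD mdeg1 (dhomog_mf hq mq).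
have [->|nz_q] := eqVneq q 0.
  by rewrite mulr0; apply: reduced_tail => m; rewrite msupp0.
have nB : (n < n.+2)%N by [].
have [u lead_u] := lead_mono_exists hq nz_q.
have Mu : M u by apply/ME; exists q.
have /(lead_monoP _ nB hq) [uq min_u] := lead_u.
have deg_u : mdeg u = n by rewrite (dhomog_mf hq uq).
have [Ihu hhu lead_hu shape_u] := hh _ Mu deg_u.
have [a [q' [-> Iq' hq' q'u]]] := cancel_lead nB Iq hq Ihu hhu lead_hu min_u.
have Nu := qN _ uq.
rewrite mulrDr -scalerAr; apply: reducedD.
  apply: IH => // m /q'u lt_um; apply: leq_trans Nu _.
  by rewrite addSn -addnS leq_add2l /w !wtD -addnS leq_add2l.
apply: reducedZ.
have [/forallP top_k|] := boolP [forall l : 'I_r, (k < l)%N ==> (u l == 0%N)].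
  by apply: reduced_base => // l lt_kl; apply/eqP/(implyP (top_k l)).
rewrite negb_forall => /existsP [l]; rewrite negb_imply -lt0n => /andP[lt_kl ul].
case: shape_u => [min_u'|[K [h' [d [v [huE nE [Ih' hh'] lead_v [uE topK]]]]]]].
  apply: reduced_tail => m /mem_msuppXM [m' m'h ->].
  apply: leq_trans (hb _ _ _ min_u' deg_u lt_kl ul) _; rewrite !wtD leq_add2l.
  by have /(lead_monoP _ nB hhu) [_ ->] := lead_hu.
have lt_kK : (k < K)%N.
  apply: leq_trans lt_kl _; rewrite leqNgt; apply/negP => /topK ul0.
  by rewrite ul0 in ul.
(* Read [X_k X_K h'] as [X_K (X_k h')] and divide [X_k h'] by [h v']: as [K >= max(v')], the product
   [X_K h_v'] is admissible, and the remainder has larger weights. *)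
pose v' := (U_(k) + v)%MM.
have hXh' : 'X_k * h' \is n.-homog by rewrite nE dhomogXM.
have lead_v' : lead_mono ('X_k * h') v' by apply: (lead_monoXM k hh' lead_v).
have IXh' : in_ideal gs ('X_k * h') by apply: in_idealM.
have Mv' : M v' by apply/ME; exists ('X_k * h').
have /(lead_monoP _ nB hXh') [v'h min_v'] := lead_v'.
have deg_v' : mdeg v' = n by rewrite (dhomog_mf hXh' v'h).
have [Ihv hhv lead_hv _] := hh _ Mv' deg_v'.
have [a' [q'' [XE Iq'' hq'' q''v]]] := cancel_lead nB IXh' hXh' Ihv hhv lead_hv min_v'.
rewrite huE mulrCA XE mulrDr -scalerAr; apply: reducedD.
  apply: IH => // m /q''v lt_vm; apply: leq_trans Nu _.
  rewrite addSn -addnS leq_add2l /w uE !wtD addnCA -addnS leq_add2l.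
  by rewrite -wtD.
apply/reducedZ/reduced_base => // j lt_Kj.
move: (topK _ lt_Kj); rewrite uE !mnmDE => /eqP; rewrite addn_eq0 => /andP[_ /eqP ->].
rewrite mnm1E addn0 (_ : k == j = false) // -(inj_eq val_inj) ltn_eqF //.
exact: ltn_trans lt_Kj.
Qed.

(** Genericity enters only through strong stability. If no pair [J], [i] worked, every product
    [X_i J] would have weight above that of [P], so an ideal element led by [P] would be [reduced],
    against [reduced_lead]. *)
Lemma min_gen_below_syzygy r n (gs : seq {mpoly CC[r]}) (M : 'X_{1..r} -> Prop) P :
  (forall p, p \in gs -> exists d, (d <= n)%N /\ homogeneous_of d p) ->
  (forall m, M m <-> in_initial gs m) -> strongly_stable M ->
  min_gen M P -> mdeg P = n.+1 ->
  exists (J : 'X_{1..r}) (i : 'I_r),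
    [/\ min_gen M J, mdeg J = n,
        (exists k : 'I_r, (i < k)%N /\ (0 < J k)%N)
      & revlex_lt P (mul_var i J)].
Proof.
move=> hgs ME stM minP degP; apply: NNPP => no.
have {}hgs p : p \in gs -> p \is ((msize p).-1).-homog /\ ((msize p).-1 <= n)%N.
  move=> /hgs [d [le_dn /homogeneous_ofE /homog_degree_le [hp le_p]]].
  by split=> //; apply: leq_trans le_dn.
have hgs1 p : p \in gs -> p \is ((msize p).-1).-homog by case/hgs.
have Mhomog m : M m -> exists p, [/\ in_ideal gs p, p \is (mdeg m).-homog & lead_mono p m].
  by move/ME/(in_initial_homog hgs1).
have upM i m : M m -> M (U_(i) + m)%MM.
  move=> /Mhomog [p [Ip hp lead_p]]; apply/ME; exists ('X_i * p).
  by split; [apply: in_idealM|exact: lead_monoXM hp lead_p].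
have mul_varE i (J : 'X_{1..r}) : mul_var i J = (U_(i) + J)%MM.
  by apply/mnmP => l; rewrite mnmE mnmDE mnm1E addnC eq_sym.
have hb (J : 'X_{1..r}) (i k : 'I_r) : min_gen M J -> mdeg J = n -> (i < k)%N ->
    (0 < J k)%N -> (wt n.+2 P < wt n.+2 (U_(i) + J)%MM)%N.
  move=> minJ degJ lt_ik Jk; have degUJ : mdeg (U_(i) + J)%MM = n.+1.
    by rewrite mdegD mdeg1 degJ.
  rewrite ltn_neqAle; apply/andP; split.
    apply/eqP => /wt_inj PE; have {PE} PE : P = (U_(i) + J)%MM.
      by apply: PE; rewrite ?degP ?degUJ.
    have JP : J = P.
      case: minP => _; apply; first by case: minJ.
      by rewrite PE => l; rewrite mnmDE leq_addl.
    by move: degP; rewrite -JP degJ => /n_Sn.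
  rewrite leqNgt; apply/negP => lt_P; apply: no; exists J, i; split=> //.
    by exists k.
  by rewrite mul_varE; apply/(@revlex_ltP _ n.+2) => //; rewrite ?degP ?degUJ.
(* The value [0] is a default for those [u] that are not monomials of [M] of degree [n]. *)
have ex_h u : exists hu, M u -> mdeg u = n ->
    [/\ in_ideal gs hu, hu \is n.-homog, lead_mono hu u &
        min_gen M u \/ exists (K : 'I_r) h' d v,
          [/\ hu = 'X_K * h', n = d.+1, in_ideal gs h' /\ h' \is d.-homog,
              lead_mono h' v & u = (U_(K) + v)%MM /\
              forall l : 'I_r, (K < l)%N -> u l = 0%N]].
  have [[Mu deg_u]|nu] := classic (M u /\ mdeg u = n); last first.
    by exists 0 => Mu deg_u; case: nu.
  have [min_u|nmin_u] := classic (min_gen M u).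
    have [p [Ip hp lead_p]] := Mhomog _ Mu; exists p => _ _.
    by rewrite -deg_u; split=> //; left.
  have [K [v [uE Mv topK]]] := not_min_gen upM stM Mu nmin_u.
  have [p [Ip hp lead_p]] := Mhomog _ Mv; exists ('X_K * p) => _ _.
  have nE : n = (mdeg v).+1 by rewrite -deg_u uE mdegD mdeg1.
  split; [exact: in_idealM|by rewrite nE dhomogXM| |].
    by rewrite uE; exact: lead_monoXM hp lead_p.
  by right; exists K, p, (mdeg v), v.
have [h hh] := functional_choice _ ex_h.
have [p [Ip hp lead_p]] : exists p, [/\ in_ideal gs p, p \is (mdeg P).-homog & lead_mono p P].
  by apply: Mhomog; case: minP.
rewrite degP in hp.
apply: (@reduced_lead r n M h p P) => //.
- by move=> u Mu deg_u; have [] := hh _ Mu deg_u.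
- move=> u k Mu PE; have uP : u = P.
    by case: minP => _; apply=> // l; rewrite PE mnmDE leq_addl.
  have := congr1 (@mdeg r) PE.
  by rewrite -uP mdegD mdeg1 => /n_Sn.
have [q [-> hq]] := in_ideal_succ hgs Ip hp.
apply: (big_ind (reduced n.+2 n M h (wt n.+2 P))).
- by apply: reduced_tail => m; rewrite msupp0.
- exact: reducedD.
by move=> i _; have [Iq hqi] := hq i; apply: (reduced_XM ME).
Qed.

(** * Nonvanishing of polynomials and generic matrices *)

Lemma CC_natr_eq0 n : (n%:R == 0 :> CC) = (n == 0)%N.
Proof.
exact: (@Num.Theory.pnatr_eq0 (complex Rdefinitions.R) n).
Qed.

(** In characteristic 0 the naturals below [size p] are distinct, and there are more of them than
    roots of [p]. *)
Lemma poly_nonroot (p : {poly CC}) : p != 0 -> exists s, p.[s] != 0.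
Proof.
move=> nz_p; pose rs := [seq n%:R : CC | n <- iota 0 (size p)].
have uniq_rs : uniq rs.
  rewrite map_inj_uniq ?iota_uniq //.
  have le_inj a b : (a <= b)%N -> a%:R = b%:R :> CC -> a = b.
    move=> le_ab /eqP; rewrite eq_sym -subr_eq0 -natrB // CC_natr_eq0 subn_eq0.
    by move=> le_ba; apply/eqP; rewrite eqn_leq le_ab.
  move=> a b eq_ab; case/orP: (leq_total a b) => le_ab; first exact: le_inj.
  by apply/esym/le_inj.
have /allPn [s _ nroot] : ~~ all (root p) rs.
  apply/negP => /(max_poly_roots nz_p)/(_ uniq_rs).
  by rewrite size_map size_iota ltnn.
by exists s.
Qed.

(* Kronecker substitution [X_i := s ^ (B ^ i)]. *)
Lemma mpoly_nonroot N (f : {mpoly CC[N]}) : f != 0 -> exists v, f.@[v] != 0.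
Proof.
move=> nz_f; pose B := msize f.
pose F : {poly CC} := \sum_(m <- msupp f) f@_m *: 'X^(wt B m).
(* All degrees are below [B], so distinct monomials get distinct powers and nothing cancels the term
   of [mlead f]. *)
have nz_F : F != 0.
  apply/eqP => /(congr1 (fun p : {poly CC} => p`_(wt B (mlead f)))).
  rewrite coef0 coef_sum (bigD1_seq (mlead f)) ?mlead_supp ?msupp_uniq //=.
  rewrite big_seq_cond big1 => [|m /andP[mf ne_m]].
    rewrite coefZ coefXn eqxx mulr1 addr0 => /eqP.
    by rewrite mleadc_eq0 (negbTE nz_f).
  rewrite coefZ coefXn; case: eqP => [eq_wt|_]; last by rewrite mulr0.
  case/eqP: ne_m; apply/esym/(wt_inj _ _ eq_wt); apply: msize_mdeg_lt => //.
  exact: mlead_supp.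
have [s Fs] := poly_nonroot nz_F; exists (fun i => s ^+ (B ^ i)).
suff -> : f.@[fun i => s ^+ (B ^ i)] = F.[s] by [].
rewrite mevalE horner_sum; apply: eq_bigr => m _.
rewrite hornerZ hornerXn /wt expr_sum; congr (_ * _).
by apply: eq_bigr => i _; rewrite -exprM mulnC.
Qed.

Lemma meval_mxvec r N (A : 'M[{mpoly CC[N]}]_r) (v : 'I_N -> CC) k :
  (mxvec A 0 k).@[v] = mxvec (map_mx (meval v) A) 0 k.
Proof. by rewrite -map_mxvec mxE. Qed.

(** All three conditions say that a polynomial in the entries of [g] does not vanish, and a product
    of nonzero polynomials is nonzero. *)
Lemma generic_matrix r (f : {mpoly CC[r * r]}) (a : 'M[CC]_r) :
  f != 0 -> a \in unitmx ->
  exists g : 'M[CC]_r, [/\ g \in unitmx,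
    meval (fun k => mxvec g 0 k) f != 0
    & meval (fun k => mxvec (g *m a) 0 k) f != 0].
Proof.
move=> nz_f ua.
pose G : 'M[{mpoly CC[r * r]}]_r := \matrix_(i, j) 'X_(mxvec_index i j).
have evG g : map_mx (meval (fun k => mxvec g 0 k)) G = g.
  by apply/matrixP => i j; rewrite !mxE mevalXU mxvecE.
pose fa := f \mPo [tuple (mxvec (G *m map_mx (@mpolyC _ CC) a)) 0 k | k < r * r].
have evfa g : fa.@[fun k => mxvec g 0 k] = f.@[fun k => mxvec (g *m a) 0 k].
  rewrite comp_mpoly_meval; apply: meval_eq => k.
  rewrite tnth_mktuple meval_mxvec map_mxM evG; congr ((mxvec (_ *m _)) 0 k).
  by apply/matrixP => i j; rewrite !mxE; exact: mevalC.
(* [fa] is [f] after right multiplication by [a]; evaluating it at a matrix times the inverse of [a]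
   recovers the value of [f]. *)
have nz_fa : fa != 0.
  have [v fv] := mpoly_nonroot nz_f; apply: contra_neq fv => fa0.
  have := evfa (vec_mx (\row_k v k) *m invmx a).
  rewrite fa0 meval0 mulmxKV // vec_mxK => ->.
  by apply: meval_eq => k; rewrite mxE.
have evdet g : (\det G).@[fun k => mxvec g 0 k] = \det g.
  by rewrite -det_map_mx evG.
have nz_det : \det G != 0.
  have /eqP := evdet 1%:M; rewrite det1.
  by apply: contraTneq => ->; rewrite meval0 eq_sym oner_eq0.
have [v] : exists v, (\det G * f * fa).@[v] != 0.
  by apply: mpoly_nonroot; rewrite !mulf_neq0.
have vE : v =1 (fun k => mxvec (vec_mx (\row_k v k)) 0 k).
  by move=> k; rewrite vec_mxK mxE.
rewrite !mevalM !(meval_eq _ vE) evdet evfa !mulf_eq0 !negb_or.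
move=> /andP[/andP[ug fg] fag]; exists (vec_mx (\row_k v k)).
by rewrite unitmxE unitfE.
Qed.

(** Along a matrix curve with polynomial entries, genericity becomes the nonvanishing of one
    univariate polynomial. *)
Lemma meval_poly_curve r (f : {mpoly CC[r * r]}) (A : 'M[{poly CC}]_r) :
  exists F : {poly CC}, forall s,
    F.[s] = meval (fun k => mxvec (map_mx (horner_eval s) A) 0 k) f.
Proof.
exists (\sum_(m <- msupp f) f@_m *: \prod_k (mxvec A 0 k) ^+ m k) => s.
rewrite mevalE horner_sum; apply: eq_bigr => m _.
rewrite hornerZ horner_prod; congr (_ * _); apply: eq_bigr => k _.
by rewrite horner_exp -map_mxvec mxE.
Qed.

(** The matrix is triangular once the indices are ordered by [w]; a kernel vector vanishes entry by
    entry in increasing [w]. *)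
Lemma triangular_unitmx n (A : 'M[CC]_n) (w : 'I_n -> nat) :
  (forall a, A a a != 0) ->
  (forall a b, a != b -> A a b != 0 -> (w b < w a)%N) -> A \in unitmx.
Proof.
move=> diag tri; rewrite -unitmx_tr -row_free_unit; apply: inj_row_free => v vA.
have v0 N a : (w a < N)%N -> v 0 a = 0.
  elim: N a => // N IH a lt_aN; have := congr1 (fun x : 'rV_n => x 0 a) vA.
  rewrite !mxE (bigD1 a) //= big1 => [|b ne_ba]; last first.
    rewrite mxE; have [->|/tri lt_ba] := eqVneq (A a b) 0; first by rewrite mulr0.
    rewrite IH ?mul0r // (leq_trans (lt_ba _)) // 1?eq_sym //.
  by rewrite mxE addr0 => /eqP; rewrite mulf_eq0 (negbTE (diag a)) orbF => /eqP.
by apply/rowP => a; rewrite mxE (v0 (w a).+1).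
Qed.

(** * Linear changes of coordinates *)

Lemma lin_change_sum r (g : 'M[CC]_r) (I : Type) (s : seq I) (F : I -> {mpoly CC[r]}) :
  lin_change g (\sum_(x <- s) F x) = \sum_(x <- s) lin_change g (F x).
Proof. exact: raddf_sum. Qed.

Lemma lin_changeZ r (g : 'M[CC]_r) a p : lin_change g (a *: p) = a *: lin_change g p.
Proof. exact: comp_mpolyZ. Qed.

Lemma lin_changeM r (g : 'M[CC]_r) p q :
  lin_change g (p * q) = lin_change g p * lin_change g q.
Proof. exact: rmorphM. Qed.

Lemma lin_changeXn r (g : 'M[CC]_r) p n : lin_change g (p ^+ n) = lin_change g p ^+ n.
Proof. exact: rmorphXn. Qed.

Lemma lin_changeU r (g : 'M[CC]_r) i : lin_change g 'X_i = \sum_(j < r) g i j *: 'X_j.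
Proof. by rewrite /lin_change comp_mpolyXU -tnth_nth tnth_mktuple. Qed.

Lemma lin_changeX r (g : 'M[CC]_r) m :
  lin_change g 'X_[m] = \prod_i lin_change g 'X_i ^+ m i.
Proof.
rewrite [in LHS]mpolyXE_id /lin_change rmorph_prod.
by apply: eq_bigr => i _; rewrite rmorphXn.
Qed.

Lemma lin_changeE r (g : 'M[CC]_r) p :
  lin_change g p = \sum_(m <- msupp p) p@_m *: lin_change g 'X_[m].
Proof.
rewrite {1}[p]mpolyE lin_change_sum.
by apply: eq_bigr => m _; rewrite lin_changeZ.
Qed.

Lemma lin_change_prod r (g : 'M[CC]_r) (I : finType) (F : I -> {mpoly CC[r]}) :
  lin_change g (\prod_x F x) = \prod_x lin_change g (F x).
Proof. exact: rmorph_prod. Qed.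

(** [X_i] goes to row [i] of [g] applied to the column of variables; substituting [h] there
    multiplies on the right. *)
Lemma lin_change_comp r (g h : 'M[CC]_r) p :
  lin_change h (lin_change g p) = lin_change (g *m h) p.
Proof.
have compU i : lin_change h (lin_change g 'X_i) = lin_change (g *m h) 'X_i.
  rewrite !lin_changeU lin_change_sum.
  transitivity (\sum_j \sum_l (g i j * h j l) *: ('X_l : {mpoly CC[r]})).
    apply: eq_bigr => j _; rewrite lin_changeZ lin_changeU scaler_sumr.
    by apply: eq_bigr => l _; rewrite scalerA.
  rewrite exchange_big; apply: eq_bigr => l _ /=.
  by rewrite mxE scaler_suml.
have compX m : lin_change h (lin_change g 'X_[m]) = lin_change (g *m h) 'X_[m].
  rewrite (lin_changeX (g *m h)) (lin_changeX g) lin_change_prod.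
  by apply: eq_bigr => i _; rewrite lin_changeXn compU.
rewrite (lin_changeE (g *m h)) (lin_changeE g) lin_change_sum.
by apply: eq_bigr => m _; rewrite lin_changeZ compX.
Qed.

Lemma dhomog_lin_change r d (g : 'M[CC]_r) p :
  p \is d.-homog -> lin_change g p \is d.-homog.
Proof.
move=> hp; rewrite lin_changeE big_seq; apply: rpred_sum => m mp.
apply: rpredZ; rewrite lin_changeX -(dhomog_mf hp mp) /= mdegE.
apply: (big_rec2 (fun (e : nat) q => q \is e.-homog)); first exact: dhomog1.
move=> i e q _ hq; apply: dhomogM => //.
have /(dhomogMn (m i)) : lin_change g 'X_i \is 1.-homog; last by rewrite mul1n.
rewrite lin_changeU; apply: rpred_sum => j _; apply: rpredZ.
by rewrite dhomogX /= mdeg1.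
Qed.

Lemma in_ideal_map r (gs : seq {mpoly CC[r]}) (f h fh : {mpoly CC[r]} -> {mpoly CC[r]}) p :
  (forall I (s : seq I) F, h (\sum_(x <- s) F x) = \sum_(x <- s) h (F x)) ->
  {morph h : p q / p * q} -> (forall p, h (f p) = fh p) ->
  in_ideal (map f gs) p -> in_ideal (map fh gs) (h p).
Proof.
move=> hsum hM hf /in_idealP [c ->]; apply/in_idealP; exists (fun k => h (c k)).
rewrite !size_map hsum; apply: eq_bigr => k _.
by rewrite hM !(nth_map 0) // hf.
Qed.

Lemma in_ideal_lin_change_comp r (gs : seq {mpoly CC[r]}) (g h : 'M[CC]_r) p :
  in_ideal (map (lin_change g) gs) p ->
  in_ideal (map (lin_change (g *m h)) gs) (lin_change h p).
Proof.
exact: in_ideal_map (lin_change_sum h) (lin_changeM h) (lin_change_comp g h).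
Qed.

Lemma lin_change_diag r (d : 'rV[CC]_r) m :
  lin_change (diag_mx d) 'X_[m] = (\prod_i d 0 i ^+ m i) *: 'X_[m].
Proof.
rewrite lin_changeX [in RHS]mpolyXE_id -scaler_prod; apply: eq_bigr => i _.
rewrite -exprZn; congr (_ ^+ _); rewrite lin_changeU (bigD1 i) //= mxE eqxx mulr1n.
by rewrite big1 ?addr0 // => j ne_ji; rewrite mxE eq_sym (negbTE ne_ji) scale0r.
Qed.

(** * Shears and strong stability of gin *)

Definition shear r (k i : 'I_r) : 'M[CC]_r := 1%:M + delta_mx k i.

Lemma shear_unit r (k i : 'I_r) : k != i -> shear k i \in unitmx.
Proof.
move=> ne_ki; have [] // := @mulmx1_unit _ _ (shear k i) (1%:M - delta_mx k i).
rewrite mulmxBr mulmx1 mulmxDl mul1mx mul_delta_mx_cond eq_sym (negbTE ne_ki).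
by rewrite mulr0n addr0 addrK.
Qed.

Definition shear_mnm r (k i : 'I_r) (m : 'X_{1..r}) (a : nat) : 'X_{1..r} :=
  (m - U_(k) *+ a + U_(i) *+ a)%MM.

(** The shear fixes every variable except [X_k], so this is the binomial theorem for the power [m k]
    of [X_k + X_i]. *)
Lemma lin_change_shear r (k i : 'I_r) m : k != i ->
  lin_change (shear k i) 'X_[m]
  = \sum_(a < (m k).+1) 'X_[shear_mnm k i m a] *+ 'C(m k, a).
Proof.
move=> ne_ki; pose m0 := (m - U_(k) *+ m k)%MM.
have mE : m = (m0 + U_(k) *+ m k)%MM.
  rewrite submK //; apply/mnm_lepP => j; rewrite mulmnE mnm1E.
  by case: eqP => [<-|_]; rewrite ?mul1n ?mul0n.
have shearU j : lin_change (shear k i) 'X_j = 'X_j + (j == k)%:R *: 'X_i.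
  rewrite lin_changeU; under eq_bigr do rewrite !mxE scalerDl.
  rewrite big_split /= (bigD1 j) //= eqxx scale1r big1 => [|l ne_l]; last first.
    by rewrite eq_sym (negbTE ne_l) scale0r.
  rewrite (bigD1 i) //= eqxx andbT big1 => [|l ne_l]; last first.
    by rewrite (negbTE ne_l) andbF scale0r.
  by rewrite !addr0.
have shear0 : lin_change (shear k i) 'X_[m0] = 'X_[m0].
  rewrite lin_changeX [in RHS]mpolyXE_id; apply: eq_bigr => j _; rewrite shearU.
  have [->|_] := eqVneq j k; last by rewrite scale0r addr0.
  by rewrite /m0 mnmBE mulmnE mnm1E eqxx mul1n subnn !expr0.
rewrite {1}mE mpolyXD -mpolyXn lin_changeM lin_changeXn shear0 shearU eqxx scale1r.
rewrite exprDn mulr_sumr; apply: eq_bigr => -[a /= lt_a] _.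
rewrite mulrnAr !mpolyXn -!mpolyXD; congr ('X_[_] *+ _).
rewrite /shear_mnm addmA; congr (_ + _)%MM.
apply/mnmP => j; rewrite mnmDE !mnmBE !mulmnE !mnm1E.
by case: eqP => [<-|_]; rewrite ?mul1n ?subnn ?mul0n ?subn0 ?addn0 ?add0n.
Qed.

Lemma wtMU r B (k : 'I_r) a : wt B (U_(k) *+ a)%MM = (a * B ^ k)%N.
Proof.
elim: a => [|a IH]; last by rewrite mulmS wtD IH wtU mulSn.
by rewrite mulm0n /wt big1 // => j _; rewrite mnm0E.
Qed.

Lemma wt_shear_mnm r B (k i : 'I_r) (m : 'X_{1..r}) a : (1 < B)%N -> (i < k)%N ->
  (0 < a <= m k)%N -> (wt B (shear_mnm k i m a) < wt B m)%N.
Proof.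
move=> B1 lt_ik /andP[a_gt0 le_a].
have mE : m = ((m - U_(k) *+ a) + U_(k) *+ a)%MM.
  rewrite submK //; apply/mnm_lepP => j; rewrite mulmnE mnm1E.
  by case: eqP => [<-|_]; rewrite ?mul1n ?mul0n.
rewrite {2}mE /shear_mnm !wtD ltn_add2l !wtMU ltn_pmul2l //.
by rewrite ltn_exp2l.
Qed.

Lemma shear_mnm0 r (k i : 'I_r) m : shear_mnm k i m 0 = m.
Proof. by rewrite /shear_mnm !mulm0n subm0 addm0. Qed.

Lemma shear_mnm1 r (k i : 'I_r) m : shear_mnm k i m 1 = (U_(i) + (m - U_(k)))%MM.
Proof. by rewrite /shear_mnm !mulm1n addmC. Qed.

(** Trading [X_k] for [X_i] with [i < k] lowers the weight. With [coef_shear_id] this makes the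
    shear unitriangular. *)
Lemma coef_shear_wt r B (k i : 'I_r) m m' : (1 < B)%N -> (i < k)%N ->
  (lin_change (shear k i) 'X_[m])@_m' != 0 -> m' = m \/ (wt B m' < wt B m)%N.
Proof.
move=> B1 lt_ik; rewrite lin_change_shear -?(inj_eq val_inj) ?gtn_eqF //.
have [[a <-]|no] := classic (exists a : 'I_(m k).+1, shear_mnm k i m a = m').
  case: a => -[|a] /= lt_a _; first by left; apply: shear_mnm0.
  by right; apply: wt_shear_mnm.
rewrite raddf_sum /= big1 ?eqxx // => a _; rewrite mcoeffMn mcoeffX.
by case: eqP => [eq_a|_]; [case: no; exists a|rewrite mul0rn].
Qed.

Lemma coef_shear_id r (k i : 'I_r) m : (i < k)%N ->
  (lin_change (shear k i) 'X_[m])@_m = 1.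
Proof.
move=> lt_ik; rewrite lin_change_shear -?(inj_eq val_inj) ?gtn_eqF //.
rewrite raddf_sum /= big_ord_recl /= shear_mnm0 mcoeffMn mcoeffX eqxx bin0.
rewrite big1 ?addr0 // => a _; rewrite mcoeffMn mcoeffX.
case: eqP => [eq_a|]; last by rewrite mul0rn.
have : (wt 2 (shear_mnm k i m (lift ord0 a)) < wt 2 m)%N.
  by apply: wt_shear_mnm => //; rewrite /= /bump /= add1n ltn_ord.
by rewrite eq_a ltnn.
Qed.

(** Only the term [a = 1] contributes, since the exponent of [X_i] separates the terms; its binomial
    coefficient is [m k]. *)
Lemma coef_shear_move r (k i : 'I_r) (m : 'X_{1..r}) : (i < k)%N -> (0 < m k)%N ->
  (lin_change (shear k i) 'X_[m])@_(U_(i) + (m - U_(k)))%MM = (m k)%:R.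
Proof.
move=> lt_ik mk; rewrite lin_change_shear -?(inj_eq val_inj) ?gtn_eqF //.
have lt1 : (1 < (m k).+1)%N by rewrite ltnS.
rewrite raddf_sum /= (bigD1 (Ordinal lt1)) //= shear_mnm1 mcoeffMn mcoeffX eqxx bin1.
rewrite big1 ?addr0 // => -[a /= lt_a] ne_a; rewrite mcoeffMn mcoeffX.
case: eqP => [/(congr1 (fun m : 'X_{1..r} => m i))|]; last by rewrite mul0rn.
rewrite /shear_mnm !mnmDE !mnmBE !mulmnE !mnm1E !eqxx.
rewrite (_ : k == i = false) ?mul0n ?subn0 ?mul1n; last first.
  by rewrite -(inj_eq val_inj) gtn_eqF.
rewrite addnC => /addIn eq_a.
by case/eqP: ne_a; apply: val_inj.
Qed.

(* With [m' := X_i m / X_k], elements of the degenerated and sheared ideal solve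
   a linear system, invertible near [s = 0], that prescribes coefficient [0] at
   the monomials of [M] above [m'] and [1] at [m']; so [m'] is leading. *)
Lemma gin_strongly_stable r (gs : seq {mpoly CC[r]}) (M : 'X_{1..r} -> Prop) :
  (forall p, p \in gs -> exists d, homogeneous_of d p) ->
  is_gin gs M -> strongly_stable M.
Proof.
move=> hgs [f [nz_f ginM]] m i k lt_ik mk Mm.
have ne_ki : k != i by rewrite -(inj_eq val_inj) gtn_eqF.
(* [B] exceeds both [d], so that [wt] is injective, and [1], so that the shear lowers weights. *)
set m' := (U_(i) + (m - U_(k)))%MM; pose d := mdeg m; pose B := d.+2.
have dB : (d < B)%N by rewrite /B ltnS leqnSn.
pose c := shear k i; have uc : c \in unitmx by apply: shear_unit.
(* Genericity of [g] gives ideal elements led by the monomials of [M]; that of [g c] will make [F]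
   nonzero at [s = 1]. *)
have [g [ug fg fgc]] := generic_matrix nz_f uc.
have deg_m' : mdeg m' = d by rewrite /d -(submUK mk) /m' !mdegD !mdeg1.
have lt_m' : (wt B m' < wt B m)%N.
  by rewrite /m' -(shear_mnm1 k i m); apply: wt_shear_mnm.
pose gs1 := map (lin_change g) gs.
have hgs1 p : p \in gs1 -> p \is ((msize p).-1).-homog.
  case/mapP => q /hgs [e /homogeneous_ofE hq] ->.
  by have [] := homog_degree_le (dhomog_lin_change g hq).
have ex_p w : exists p, M w ->
    [/\ in_ideal gs1 p, p \is (mdeg w).-homog & lead_mono p w].
  have [/ginM Mw|] := classic (M w); last by exists 0.
  by have [p hp] := in_initial_homog hgs1 (Mw _ ug fg); exists p.
have [pw hpw] := functional_choice _ ex_p.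
(* [L] will list the monomials of [M] in degree [d] above [m'], that is, of smaller weight. *)
pose above (w : 'X_{1..r < d.+1}) : bool :=
  if excluded_middle_informative [/\ M w, mdeg w = d & (wt B w < wt B m')%N]
  then true else false.
pose L : seq 'X_{1..r} := map val (enum above).
have uniq_L : uniq L by rewrite map_inj_uniq ?enum_uniq //; apply: val_inj.
have LP w : w \in L <-> [/\ M w, mdeg w = d & (wt B w < wt B m')%N].
  split=> [/mapP [x]|hw].
    by rewrite mem_enum unfold_in /above; case: excluded_middle_informative => // hx _ ->.
  have lt_w : (mdeg w < d.+1)%N by case: hw => _ -> _.
  apply/mapP; exists (BMultinom lt_w) => //; rewrite mem_enum unfold_in /above.
  by case: excluded_middle_informative.
pose N := (size L).+1.
(* Rows of the system start with [m], columns with [m']; both continue with [L]. *)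
pose T (a : 'I_N) := nth 0%MM (m :: L) a.
pose T' (a : 'I_N) := nth 0%MM (m' :: L) a.
have TS (a : 'I_N) : a != 0 -> T a = T' a /\ T' a \in L.
  case: a => -[//|a] lt_a _; split=> //.
  exact: mem_nth.
have MT a : M (T a) /\ mdeg (T a) = d.
  have [->|/TS [->]] := eqVneq a 0; first by [].
  by case/LP.
have T'inj : injective T'.
  move=> a b /eqP; rewrite nth_uniq ?ltn_ord // => [/eqP/val_inj //|].
  by rewrite /= uniq_L andbT; apply/negP => /LP [_ _]; rewrite ltnn.
(* The coefficient at [T' b] of [pw (T a)] after torus and shear, divided by [s ^ wt B (T a)]; this
   stays polynomial in [s] because [T a] has least weight in [pw (T a)]. *)
pose A : 'M[{poly CC}]_N := \matrix_(a, b)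
  \sum_(u <- msupp (pw (T a)))
    ((pw (T a))@_u * (lin_change c 'X_[u])@_(T' b)) *: 'X^(wt B u - wt B (T a)).
(* At [s = 0] only the leading term of [pw (T a)] survives. Up to leading coefficients the diagonal
   is [m k] in row [0] and [1] elsewhere, and the shear is triangular for the weight. *)
have A0 : map_mx (horner_eval 0) A \in unitmx.
  have A0E a b : map_mx (horner_eval 0) A a b
      = (pw (T a))@_(T a) * (lin_change c 'X_[T a])@_(T' b).
    have [_ hp lead_p] := hpw _ (MT a).1; rewrite (MT a).2 in hp.
    have /(lead_monoP _ dB hp) [Tp min_T] := lead_p.
    rewrite !mxE /horner_eval horner_sum (bigD1_seq (T a)) ?msupp_uniq //=.
    rewrite subnn hornerZ hornerXn expr0 mulr1 big_seq_cond big1 ?addr0 //.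
    move=> u /andP[up ne_u]; rewrite hornerZ hornerXn expr0n subn_eq0.
    rewrite (_ : (_ <= _)%N = false) ?mulr0 //; apply/negbTE.
    rewrite -ltnNge ltn_neqAle min_T // andbT; apply: contra_neq ne_u => eq_wt.
    by apply/esym/(wt_inj _ _ eq_wt); rewrite (dhomog_mf hp).
  have lc a : (pw (T a))@_(T a) != 0.
    by have [_ _ []] := hpw _ (MT a).1; rewrite mcoeff_msupp.
  apply: (@triangular_unitmx _ _ (fun a => wt B (T' a))) => [a|a b ne_ab].
    rewrite A0E mulf_neq0 //; have [->|/TS [-> _]] := eqVneq a 0.
      by rewrite coef_shear_move // CC_natr_eq0 -lt0n.
    by rewrite coef_shear_id // oner_eq0.
  rewrite A0E mulf_eq0 negb_or => /andP[_ nz_ab].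
  have [a0|/TS [Ta _]] := eqVneq a 0.
    have /TS [_ /LP[_ _]] : b != 0 by rewrite -a0 eq_sym.
    by rewrite a0.
  have B1 : (1 < B)%N by [].
  move: nz_ab; rewrite Ta => /(coef_shear_wt B1 lt_ik) [/T'inj eq_ba|//].
  by rewrite eq_ba eqxx in ne_ab.
pose bX : 'rV[{poly CC}]_r := \row_j 'X^(B ^ j).
pose bs s : 'rV[CC]_r := \row_j s ^+ (B ^ j).
have [F FE] := meval_poly_curve f (map_mx polyC g *m diag_mx bX *m map_mx polyC c).
have {}FE s : F.[s] = meval (fun j => mxvec (g *m diag_mx (bs s) *m c) 0 j) f.
  rewrite FE; apply: meval_eq => j; congr (mxvec _ 0 j).
  rewrite !map_mxM /=; congr (_ *m _ *m _); apply/matrixP => x y; rewrite !mxE.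
  - by rewrite /horner_eval hornerC.
  - by rewrite /horner_eval hornerMn hornerXn.
  by rewrite /horner_eval hornerC.
have nz_F : F != 0.
  apply: contraNneq fgc => F0.
  have := FE 1; rewrite F0 horner0 (_ : diag_mx (bs 1) = 1%:M) ?mulmx1 => [<- //|].
  by apply/matrixP => x y; rewrite !mxE expr1n.
have nz_A : \det A != 0.
  move: A0; rewrite unitmxE det_map_mx unitfE /=.
  by apply: contraNneq => ->; rewrite /horner_eval horner0.
(* Such an [s] keeps the torus element invertible, the composite generic and the system solvable. *)
have [s] : exists s, ('X * F * \det A).[s] != 0.
  by apply: poly_nonroot; rewrite !mulf_neq0 // polyX_eq0.
rewrite !hornerM hornerX !mulf_eq0 !negb_or => /andP[/andP[nz_s Fs] As].
pose h := g *m diag_mx (bs s) *m c.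
have uh : h \in unitmx.
  rewrite !unitmx_mul ug uc andbT /= unitmxE det_diag unitfE.
  by apply/prodf_neq0 => j _; rewrite mxE expf_neq0.
have fh : meval (fun j => mxvec h 0 j) f != 0 by rewrite -FE.
pose As' := map_mx (horner_eval s) A.
have uAs : As' \in unitmx by rewrite unitmxE det_map_mx unitfE.
pose Q a := lin_change c (lin_change (diag_mx (bs s)) (pw (T a))).
have IQ a : in_ideal (map (lin_change h) gs) (Q a).
  have [Ip _ _] := hpw _ (MT a).1.
  exact: in_ideal_lin_change_comp (in_ideal_lin_change_comp (diag_mx (bs s)) Ip).
have hQ a : Q a \is d.-homog.
  by do 2 apply: dhomog_lin_change; have [_ + _] := hpw _ (MT a).1; rewrite (MT a).2.
have QE a b : (Q a)@_(T' b) = s ^+ wt B (T a) * As' a b.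
  have [_ hp lead_p] := hpw _ (MT a).1; rewrite (MT a).2 in hp.
  have /(lead_monoP _ dB hp) [Tp min_T] := lead_p.
  rewrite /Q (lin_changeE (diag_mx _)) lin_change_sum raddf_sum /=.
  rewrite !mxE /horner_eval horner_sum mulr_sumr !big_seq; apply: eq_bigr => u up.
  rewrite lin_change_diag !lin_changeZ !mcoeffZ hornerZ hornerXn.
  rewrite (_ : \prod_j _ = s ^+ wt B u); last first.
    by rewrite /wt expr_sum; apply: eq_bigr => j _; rewrite mxE -exprM mulnC.
  by rewrite -[in LHS](subnKC (min_T _ up)) exprD -!mulrA mulrCA; congr (_ * _);
     rewrite mulrCA mulrC !mulrA.
(* Row [0] of the inverse, with the factor [s ^ wt B (T a)] undone, prescribes [1] at [m'] and [0]
   on [L]. *)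
pose v a := invmx As' 0 a / s ^+ wt B (T a).
pose q := \sum_a v a *: Q a.
have qE b : q@_(T' b) = (0 == b)%:R.
  have := congr1 (fun x : 'M[CC]_N => x 0 b) (mulVmx uAs); rewrite !mxE => <-.
  rewrite raddf_sum /=; apply: eq_bigr => a _.
  by rewrite mcoeffZ QE /v mulrA divfK // expf_neq0.
have Iq : in_ideal (map (lin_change h) gs) q.
  by apply: in_ideal_sum => a; apply: in_idealZ.
have hq : q \is d.-homog by apply: rpred_sum => a _; apply: rpredZ.
have qm' : m' \in msupp q.
  by rewrite mcoeff_msupp (qE 0) eqxx oner_eq0.
have nz_q : q != 0 by apply: contraTneq qm' => ->; rewrite msupp0.
have [u lead_u] := lead_mono_exists hq nz_q.
have Mu : M u by apply/(ginM _ uh fh); exists q.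
have /(lead_monoP _ dB hq) [uq min_u] := lead_u.
(* If it differs from [m'], the leading monomial [u] lies in [L], where the coefficients of [q]
   vanish. *)
have [eq_u|ne_u] := eqVneq u m'; first by rewrite -eq_u.
have deg_u : mdeg u = d by rewrite (dhomog_mf hq uq).
have uL : u \in L.
  apply/LP; split=> //; rewrite ltn_neqAle min_u // andbT.
  by apply: contra_neq ne_u => eq_wt; apply: wt_inj eq_wt; rewrite ?deg_u ?deg_m'.
have lt_ix : ((index u L).+1 < N)%N by rewrite ltnS index_mem.
have := qE (Ordinal lt_ix); rewrite /T' /= nth_index // => qu0.
by move: uq; rewrite mcoeff_msupp qu0 eqxx.
Qed.

Theorem theorem4 (r n : nat) (gs : seq {mpoly CC[r]}) (M : 'X_{1..r} -> Prop) :
  (forall p, p \in gs -> exists d, (d <= n)%N /\ homogeneous_of d p) ->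
  is_gin gs M ->
  forall P : 'X_{1..r},
    min_gen M P -> mdeg P = n.+1 ->
    exists (J : 'X_{1..r}) (i : 'I_r),
      [/\ min_gen M J, mdeg J = n,
          (exists k : 'I_r, (i < k)%N /\ (0 < J k)%N)
        & revlex_lt P (mul_var i J)].
Proof.
move=> hgs ginM P.
have stM : strongly_stable M.
  by apply: gin_strongly_stable ginM => p /hgs [d [_ hp]]; exists d.
have [f [nz_f ginE]] := ginM.
have [g [ug fg _]] := generic_matrix nz_f (unitmx1 CC r).
apply: (@min_gen_below_syzygy r n (map (lin_change g) gs)) => //.
  move=> p /mapP [q /hgs [d [le_dn /homogeneous_ofE hq]] ->]; exists d; split=> //.
  by apply/homogeneous_ofE/dhomog_lin_change.
exact: ginE.
Qed.
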